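(* Let $G$ be a finite simple graph of order $n \ge 4$ such that both $G$ and its complement $\overline{G}$ are connected. Then $Z(G) \le n-3$.
   Context: For a finite simple graph $G$, color a set $S\subseteq V(G)$ black and all other vertices white. The color-change rule: if a black vertex $u$ has exactly one white neighbor $w$, then $w$ is turned black. $S$ is a zero forcing set of $G$ if repeated application of the color-change rule eventually turns all vertices black. The zero forcing number $Z(G)$ is the minimum cardinality of a zero forcing set of $G$. The complement $\overline{G}$ has vertex set $V(G)$, with $uv$ an edge iff $uv$ is not an edge of $G$. *)

(* Defs.v *)
From mathcomp Require Import all_boot.

Set Implicit Arguments.
Unset Strict Implicit.
Unset Printing Implicit Defensive.

Record sgraph := SGraph {
  vertex :> finType;
  adj : rel vertex;
  adj_sym : symmetric adj;
  adj_irr : irreflexive adj }.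

Definition neighbors (G : sgraph) (u : G) : {set G} := [set v | adj u v].

Definition compl_adj (G : sgraph) : rel G :=
  [rel u v | (u != v) && ~~ adj u v].

Lemma compl_adj_sym (G : sgraph) : symmetric (@compl_adj G).
Proof. by move=> u v; rewrite /compl_adj /= eq_sym adj_sym. Qed.

Lemma compl_adj_irr (G : sgraph) : irreflexive (@compl_adj G).
Proof. by move=> u; rewrite /compl_adj /= eqxx. Qed.

Definition compl_graph (G : sgraph) : sgraph :=
  SGraph (@compl_adj_sym G) (@compl_adj_irr G).

Definition connected_graph (G : sgraph) : Prop :=
  forall u v : G, connect (@adj G) u v.

(* One application of the color-change rule: [B] and [C] are the sets of black
   vertices before and after. *)
Definition color_change (G : sgraph) : rel {set G} :=
  [rel B C : {set G} |
     [exists u in B, exists w,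
        (neighbors u :\: B == [set w]) && (C == w |: B)]].

Definition zero_forcing_set (G : sgraph) (S : {set G}) : bool :=
  connect (@color_change G) S [set: G].

Lemma zero_forcing_setT (G : sgraph) : zero_forcing_set [set: G].
Proof. exact: connect0. Qed.

(* The minimum is well defined by [zero_forcing_setT]. *)
Definition zero_forcing_number (G : sgraph) : nat :=
  #|[arg min_(S < [set: G] | zero_forcing_set S) #|S|]|.

Lemma zero_forcing_number_min (G : sgraph) (S : {set G}) :
  zero_forcing_set S -> zero_forcing_number G <= #|S|.
Proof.
move=> zS; rewrite /zero_forcing_number.
by case: arg_minnP => [|A _ minA]; [exact: zero_forcing_setT | exact: minA].
Qed.

Lemma zero_forcing_number_attained (G : sgraph) :
  exists2 S : {set G}, zero_forcing_set S & #|S| = zero_forcing_number G.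
Proof.
rewrite /zero_forcing_number.
by case: arg_minnP => [|A zA _]; [exact: zero_forcing_setT | exists A].
Qed.

(* Main.v *)
Require Import Defs.
From mathcomp Require Import all_boot.
From mathcomp Require Import zify.

Set Implicit Arguments.
Unset Strict Implicit.
Unset Printing Implicit Defensive.

(** If [a - b - c - d] is an induced path, then [V \ {b, c, d}] is a zero
    forcing set: [a] forces [b], then [b] forces [c], then [c] forces [d].
    An induced path on four vertices exists by Seinsche's theorem: in a graph
    without one, every vertex set with at least two elements splits into two
    nonempty parts with all or none of the edges between them, so the graph or
    its complement is disconnected. *)

Section InducedP4.
Variable T : finType.
Implicit Types (r : rel T) (A B C : {set T}).

Definition induced_P4 r (a b c d : T) : bool :=
  [&& uniq [:: a; b; c; d], r a b, r b c, r c d, ~~ r a c, ~~ r a d & ~~ r b d].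

Definition homogeneous_split r A : Prop :=
  exists B, [/\ B != set0, B \proper A &
    exists t : bool, {in B & A :\: B, forall x y, r x y = t}].

(** Negation on the diagonal too, so that it is involutive. [induced_P4] and [homogeneous_split]
    only compare distinct vertices. *)
Definition rel_compl r : rel T := fun x y => ~~ r x y.

Lemma rel_compl_sym r : symmetric r -> symmetric (rel_compl r).
Proof. by move=> rC x y; rewrite /rel_compl rC. Qed.

(** The path on four vertices is self-complementary: the non-edges of [a - b - c - d] form the path
    [b - d - a - c]. *)
Lemma induced_P4_compl r a b c d : symmetric r ->
  induced_P4 (rel_compl r) a b c d -> induced_P4 r b d a c.
Proof.
move=> rC; rewrite /induced_P4 /rel_compl !negbK.
case/and5P=> [abcd ab bc cd /and3P[ac ad bd]].
rewrite bd rC ad ac rC ab bc rC cd !andbT.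
by rewrite (@perm_uniq _ _ [:: a; b; c; d]) //; apply/permP => p /=; lia.
Qed.

Lemma homogeneous_split_compl r A :
  homogeneous_split (rel_compl r) A -> homogeneous_split r A.
Proof.
case=> B [B0 BA [t Bt]]; exists B; split=> //; exists (~~ t) => x y xB yB.
by rewrite -(Bt x y xB yB) negbK.
Qed.

(* If [x] has a neighbour on both sides and a non-neighbour [y] in [B], either
   the non-neighbours of [x] in [B] split off, or an edge from them to a
   neighbour of [x] in [B] extends to an induced path through [x] into [C]. *)
Lemma split_add_nonneighbor r x y A B : symmetric r -> x \notin A ->
  B \subset A -> {in B & A :\: B, forall u v, r u v = false} ->
  (exists2 c, c \in A :\: B & r x c) -> y \in B -> ~~ r x y ->
  homogeneous_split r (x |: A) \/ exists a b c d, induced_P4 r a b c d.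
Proof.
move=> rC xA BA BC0 [c cC xc] yB xy.
pose M := [set v in B | ~~ r x v].
case: (boolP [exists u in B, exists v in M, r x u && r u v]).
  case/exists_inP=> u uB /exists_inP[v]; rewrite inE => /andP[vB xv] /andP[xu uv].
  right; exists c, x, u, v.
  move: (cC); rewrite inE => /andP[cB cA].
  rewrite /induced_P4 (rC c x) xc xu uv (rC c u) (rC c v) (BC0 u c) //.
  rewrite (BC0 v c) // xv !andbT /=.
  have neq z w (D : {set T}) : z \notin D -> w \in D -> z != w.
    by move=> zD wD; apply: contraNneq zD => ->.
  have [uA vA] : u \in A /\ v \in A by split; apply: (subsetP BA).
  rewrite !inE !negb_or (eq_sym c x) (neq x c A) // (neq x u A) // (neq x v A) //.
  rewrite (neq c u B) // (neq c v B) //= !andbT.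
  by apply: contraNneq xv => <-.
move=> noedge; left; exists M; split.
- by apply/set0Pn; exists y; rewrite inE yB.
- apply/properP; split.
    by apply/subsetP=> v; rewrite !inE => /andP[/(subsetP BA)-> _]; rewrite orbT.
  by exists x; rewrite !inE ?eqxx //; apply: contra xA => /andP[/(subsetP BA)].
(* A vertex [w] outside [M] is [x] itself, a vertex of [A :\: B], or a neighbour of [x] in [B];
   [noedge] handles the last case. *)
exists false => v w vM; rewrite !inE => /andP[wM /predU1P[->|wA]].
  by move: vM; rewrite inE rC => /andP[_ /negbTE].
have vB : v \in B by move: vM; rewrite inE => /andP[].
have [wB|wB] := boolP (w \in B); last by apply: BC0; rewrite // inE wB.
move: wM; rewrite wB negbK /= => xw.
apply: contraNF noedge => vw; apply/exists_inP; exists w => //.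
by apply/exists_inP; exists v => //; rewrite xw rC.
Qed.

(** If [x] has no neighbour on one side, that side splits off; if [x] is adjacent to all of [A],
    then [[set x]] splits off with all edges present. Otherwise [x] has neighbours on both sides and
    a non-neighbour on one of them, as in [split_add_nonneighbor]. *)
Lemma split_add_empty r x A B : symmetric r -> x \notin A ->
  B != set0 -> B \proper A -> {in B & A :\: B, forall u v, r u v = false} ->
  homogeneous_split r (x |: A) \/ exists a b c d, induced_P4 r a b c d.
Proof.
move=> rC xA B0 BpA BC0; have BA := proper_sub BpA.
have split_off (D : {set T}) : D \subset A -> D != set0 ->
    {in D & A :\: D, forall u v, r u v = false} ->
    {in D, forall d, r x d = false} -> homogeneous_split r (x |: A).
  move=> DA D0 DC0 xD; exists D; split=> //.
    apply/properP; split; first exact: subset_trans DA (subsetUr _ _).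
    by exists x; rewrite ?setU11 //; apply: contra xA => /(subsetP DA).
  exists false => u v uD; rewrite !inE => /andP[vD /predU1P[->|vA]].
    by rewrite rC xD.
  by apply: DC0; rewrite // inE vD.
(* By symmetry of [r], [A :\: B] can take over the role of [B]. *)
have DDB : A :\: (A :\: B) = B by rewrite setDDr setDv set0U; apply/setIidPr.
have CB0 : {in A :\: B & A :\: (A :\: B), forall u v, r u v = false}.
  by move=> u v uC; rewrite DDB rC => vB; exact: BC0.
have [/exists_inP[b bB xb]|/exists_inPn xB] := boolP [exists b in B, r x b];
  last by left; apply: (split_off B) => // d /xB/negbTE.
have [/exists_inP[c cC xc]|/exists_inPn xC] :=
    boolP [exists c in A :\: B, r x c]; last first.
  left; apply: (split_off (A :\: B)); rewrite ?subsetDl //;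
    last by move=> d /xC/negbTE.
  by rewrite setD_eq0; case/andP: BpA.
have [/exists_inP[y yA xy]|/exists_inPn xall] := boolP [exists y in A, ~~ r x y].
  have [yB|yB] := boolP (y \in B).
    by apply: split_add_nonneighbor yB xy => //; exists c.
  apply: (@split_add_nonneighbor r x y A (A :\: B)) => //; rewrite ?subsetDl //.
    by exists b => //; rewrite DDB.
  by rewrite inE yB.
left; exists [set x]; split.
- by apply/set0Pn; exists x; rewrite set11.
- apply/properP; split; first exact: subsetUl.
  exists b; first by rewrite inE (subsetP BA) ?orbT.
  by rewrite inE; apply: contraNneq xA => <-; apply: (subsetP BA).
exists true => u v /set1P->; rewrite !inE => /andP[/negbTE-> /= vA].
by move/xall: vA; rewrite negbK.
Qed.

(** Induction on [#|A|], removing a vertex [x] and putting it back. Both alternatives are preserved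
    by complementation, so a split of [A :\ x] with all edges present reduces to one with none. *)
Lemma homogeneous_split_or_P4 r A : symmetric r -> 1 < #|A| ->
  homogeneous_split r A \/ exists a b c d, induced_P4 r a b c d.
Proof.
move=> rC; have [n] := ubnP #|A|; elim: n A => // n IHn A leAn A1.
have [x xA] : exists x, x \in A by apply/set0Pn; rewrite -card_gt0 ltnW.
have cardA := cardsD1 x A; rewrite xA add1n in cardA.
have xA' : x \notin A :\ x by rewrite setD11.
rewrite -(setD1K xA).
(* When [A] has just two vertices, its singletons form a split. *)
have [A'1|A'1] := leqP #|A :\ x| 1.
  have /cards1P[y defA'] : #|A :\ x| == 1.
    by rewrite eqn_leq A'1 -ltnS -cardA.
  left; exists [set x]; rewrite defA'; rewrite defA' inE in xA'; split.
  - by apply/set0Pn; exists x; rewrite set11.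
  - apply/properP; split; first exact: subsetUl.
    by exists y; rewrite !inE ?eqxx ?orbT // eq_sym.
  exists (r x y) => u v /set1P->; rewrite !inE.
  by case/andP=> /negbTE-> /eqP->.
have [||[B [B0 BA [[] Bt]]]|] := IHn (A :\ x) => //; last by right.
- by rewrite -ltnS -cardA.
- have Bt' : {in B & A :\ x :\: B, forall u v, rel_compl r u v = false}.
    by move=> u v uB vB; rewrite /rel_compl Bt.
  have [/homogeneous_split_compl|[a [b [c [d P4]]]]] :=
    split_add_empty (rel_compl_sym rC) xA' B0 BA Bt'; first by left.
  by right; exists b, d, a, c; apply: induced_P4_compl.
- exact: split_add_empty Bt.
Qed.

End InducedP4.

Lemma connected_crossing_edge (G : sgraph) (B : {set G}) :
  connected_graph G -> B != set0 -> B \proper [set: G] ->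
  exists x y, [/\ x \in B, y \notin B & adj x y].
Proof.
move=> conG /set0Pn[x xB] /properP[_ [y _ yB]].
have [/exists_inP[u uB /exists_inP[v vB uv]]|noedge] :=
  boolP [exists u in B, exists v in ~: B, adj u v].
  by exists u, v; split=> //; rewrite inE in vB.
have adjB u v : adj u v -> u \in B -> v \in B.
  move=> uv uB; apply: contraNT noedge => vB; apply/exists_inP; exists u => //.
  by apply/exists_inP; exists v; rewrite // inE.
have closedB : closed (@adj G) B.
  by move=> u v uv; apply/idP/idP; apply: adjB; rewrite // adj_sym.
by rewrite -(closed_connect closedB (conG x y)) xB in yB.
Qed.

Lemma connected_induced_P4 (G : sgraph) : 1 < #|G| ->
  connected_graph G -> connected_graph (compl_graph G) ->
  exists a b c d, induced_P4 (@adj G) a b c d.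
Proof.
rewrite -cardsT => n1 conG conGc.
have [[B [B0 BT [t Bt]]]|//] := homogeneous_split_or_P4 (@adj_sym G) n1.
(* An edge of [G] leaving [B] forces [t] to be true, and an edge of the complement leaving [B]
   forces it to be false. *)
have [x [y [xB yB xy]]] := connected_crossing_edge conG B0 BT.
have [u [v [uB vB]]] := @connected_crossing_edge (compl_graph G) B conGc B0 BT.
by case/andP=> _; rewrite (Bt u v) ?inE ?vB // -(Bt x y) ?inE ?yB ?xy.
Qed.

Lemma zero_forcing_set_force (G : sgraph) (S : {set G}) (u w : G) :
  u \in S -> neighbors u :\: S = [set w] -> zero_forcing_set (w |: S) ->
  zero_forcing_set S.
Proof.
move=> uS uw; apply: connect_trans; apply: connect1.
by apply/exists_inP; exists u => //; apply/existsP; exists w; rewrite uw !eqxx.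
Qed.

Lemma induced_P4_zero_forcing (G : sgraph) (a b c d : G) :
  induced_P4 (@adj G) a b c d -> zero_forcing_set (~: [set b; c; d]).
Proof.
case/and5P=> /=; rewrite !inE !negb_or !andbT.
case/and3P=> /and3P[ab ac ad] /andP[bc bd] cd Eab Ebc Ecd /and3P[Nac Nad Nbd].
(* Here [W] collects the white vertices other than [w]; [u] can force [w] once it has no neighbour
   in [W]. *)
have only (u w : G) (S W : {set G}) : adj u w -> ~: S = w |: W ->
    {in W, forall v, ~~ adj u v} -> neighbors u :\: S = [set w].
  move=> uw defS uW; apply/setP=> v; rewrite setDE defS !inE.
  have [->|_] /= := eqVneq v w; first by rewrite uw.
  by apply/negbTE/negP => /andP[uv /uW]; rewrite uv.
apply: (@zero_forcing_set_force _ _ a b).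
- by rewrite !inE !negb_or ab ac.
- apply: (only a b _ [set c; d]) => //; first by rewrite setCK setUA.
  by move=> v /set2P[]->.
apply: (@zero_forcing_set_force _ _ b c).
- by rewrite setU11.
- apply: (only b c _ [set d]) => //; last by move=> v /set1P->.
  apply/setP=> v; rewrite !inE.
  have [->|_] := eqVneq v b; first by rewrite (negbTE bc) (negbTE bd).
  by case: (v == c); case: (v == d).
apply: (@zero_forcing_set_force _ _ c d).
- by rewrite setU11.
- apply: (only c d _ set0) => //; last by move=> v; rewrite inE.
  apply/setP=> v; rewrite !inE.
  have [->|_] := eqVneq v c; first by rewrite (negbTE cd).
  have [->|_] := eqVneq v b; first by rewrite (negbTE bd).
  by case: (v == d).
suff -> : d |: (c |: (b |: ~: [set b; c; d])) = setT by exact: zero_forcing_setT.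
by apply/setP=> v; rewrite !inE; case: (v == b); case: (v == c); case: (v == d).
Qed.

Theorem theorem2p5 (G : sgraph) (hn : 4 <= #|G|)
    (hG : connected_graph G) (hGc : connected_graph (compl_graph G)) :
  zero_forcing_number G <= #|G| - 3.
Proof.
have n1 : 1 < #|G| by exact: leq_trans hn.
have [a [b [c [d P4]]]] := connected_induced_P4 n1 hG hGc.
have := zero_forcing_number_min (induced_P4_zero_forcing P4).
case/andP: P4 => /=; rewrite !inE !negb_or => /and4P[_ /andP[bc bd] cd _] _.
by rewrite cardsCs setCK -setUA cardsU1 cards2 !inE negb_or bc bd cd.
Qed.
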